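(* Let $G$ be a finite group with a projective unitary representation $g\mapsto U_g$ on $\mathbb{C}^d$ (i.e. $U_g$ unitary and $U_gU_h=c(g,h)U_{gh}$ with $|c(g,h)|=1$). Let $\sigma$ be a quantum state on $\mathbb{C}^d$ with spectral decomposition $\sigma=\sum_{i=0}^{d-1}\lambda_i|i\rangle\langle i|$, where $(|i\rangle)_{i}$ is an orthonormal eigenbasis, and put $\sigma_g=U_g\sigma U_g^\dagger$. For $n\in\mathbb{N}$ let $\mathcal{E}=(\frac{1}{|G|},\sigma_g^{\otimes n})_{g\in G}$ be the $n$-copy geometrically uniform ensemble, and let $\mathcal{F}=(q_{i^n,g},|i^n;g\rangle)_{i^n\in[d]^n,\,g\in G}$ be the pure-state ensemble with $q_{i^n,g}=\lambda_{i^n}/|G|$, where for $i^n=(i_1,\dots,i_n)\in[d]^n$ we set $\lambda_{i^n}=\prod_{k=1}^n\lambda_{i_k}$ and $|i^n;g\rangle=U_g^{\otimes n}(|i_1\rangle\otimes\cdots\otimes|i_n\rangle)$. Then the success probabilities of the pretty good measurements for $\mathcal{E}$ and $\mathcal{F}$ satisfy $$p_{\mathrm{PGM}}(\mathcal{E})\ \ge\ p_{\mathrm{PGM}}(\mathcal{F})\ \ge\ \sum_{i^n\in[d]^n}\frac{\lambda_{i^n}^2}{\sum_{h\in G}\prod_{k=1}^n\langle i_k|\sigma_h|i_k\rangle},$$ where terms with $\lambda_{i^n}=0$ are understood to be $0$.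
   Context: A quantum state is a positive semidefinite operator of unit trace; $[d]=\{0,\dots,d-1\}$. The pretty good measurement (PGM) of an ensemble $(p_x,\rho_x)_x$ with average state $\overline\rho=\sum_xp_x\rho_x$ is given by $M_x=p_x\,\overline\rho^{-1/2}\rho_x\,\overline\rho^{-1/2}$, with the inverse taken on the support of $\overline\rho$; its success probability is $p_{\mathrm{PGM}}=\sum_xp_x\operatorname{tr}(M_x\rho_x)$. For a pure-state ensemble $(p_x,|\varphi_x\rangle)_x$ one takes $\rho_x=|\varphi_x\rangle\langle\varphi_x|$. *)

(* Defs.v *)
From HB Require Import structures.
From mathcomp Require Import all_boot all_order all_fingroup all_algebra.
From mathcomp Require Import spectral sesquilinear complex reals.
(* [mxtens] is not imported: its notation [A ^t k] for tensor powers clashes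
   with the notation [M ^t phi] of [sesquilinear]. *)
From mathcomp Require mxtens.

Set Implicit Arguments.
Unset Strict Implicit.
Unset Printing Implicit Defensive.

Import Order.TTheory GRing.Theory Num.Theory.

Local Open Scope ring_scope.
Local Open Scope sesquilinear_scope.

(* Kets are column vectors; the inner product is conjugate-linear on the left. *)
Definition braket (C : numClosedFieldType) (d : nat) (u v : 'cV[C]_d) : C :=
  (u^t* *m v) 0 0.

Definition ketbra (C : numClosedFieldType) (d : nat) (v : 'cV[C]_d) : 'M[C]_d :=
  v *m v^t*.

Definition orthonormal_kets (C : numClosedFieldType) (d m : nat)
    (e : 'I_m -> 'cV[C]_d) : Prop :=
  forall i j, braket (e i) (e j) = (i == j)%:R.

Definition psdmx (C : numClosedFieldType) (d : nat) (A : 'M[C]_d) : Prop :=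
  A \is hermsymmx /\ forall v : 'cV[C]_d, 0 <= braket v (A *m v).

Definition quantum_state (C : numClosedFieldType) (d : nat) (A : 'M[C]_d) :
    Prop :=
  psdmx A /\ \tr A = 1.

(* For positive semidefinite [A], the operator A^(-1/2) with the inverse taken
   on the support of [A]: the function x |-> x^(-1/2) is applied to the
   eigenvalues of a unitary diagonalization of [A]. A zero eigenvalue is sent
   to 0, because sqrtC 0 = 0 and 0^-1 = 0. *)
Definition invsqrtmx (C : numClosedFieldType) (d : nat) (A : 'M[C]_d) :
    'M[C]_d :=
  (spectralmx A)^t* *m diag_mx (map_mx (fun x => (sqrtC x)^-1) (spectral_diag A))
    *m spectralmx A.

(* An ensemble over the finite index type [X] is given by its weights [p] and
   its states [rho]. *)
Definition average_state (C : numClosedFieldType) (X : finType) (d : nat)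
    (p : X -> C) (rho : X -> 'M[C]_d) : 'M[C]_d :=
  \sum_x p x *: rho x.

Definition pgm (C : numClosedFieldType) (X : finType) (d : nat)
    (p : X -> C) (rho : X -> 'M[C]_d) (x : X) : 'M[C]_d :=
  p x *: (invsqrtmx (average_state p rho) *m rho x
            *m invsqrtmx (average_state p rho)).

Definition p_pgm (C : numClosedFieldType) (X : finType) (d : nat)
    (p : X -> C) (rho : X -> 'M[C]_d) : C :=
  \sum_x p x * \tr (pgm p rho x *m rho x).

Definition projective_unitary_rep (C : numClosedFieldType) (G : finGroupType)
    (d : nat) (U : G -> 'M[C]_d) : Prop :=
  (forall g, U g \is unitarymx) /\
  exists c : G -> G -> C, forall g h,
    `|c g h| = 1 /\ U g *m U h = c g h *: U (g * h)%g.

Definition orbit_state (C : numClosedFieldType) (G : finGroupType) (d : nat)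
    (U : G -> 'M[C]_d) (sigma : 'M[C]_d) (g : G) : 'M[C]_d :=
  U g *m sigma *m (U g)^t*.

Definition tensor_power (C : numClosedFieldType) (d : nat) (A : 'M[C]_d)
    (n : nat) : 'M[C]_(d ^ n) :=
  mxtens.ntensmx A n.

(* e_0 (x) ... (x) e_n, by the same recursion as [mxtens.ntensmx_rec], so that
   the coordinates agree with those of [tensor_power]. *)
Fixpoint tensor_ket_rec (C : numClosedFieldType) (d n : nat) :
    ('I_n.+1 -> 'cV[C]_d) -> 'cV[C]_(d ^ n.+1) :=
  match n with
  | 0 => fun e => e ord0
  | n'.+1 => fun e =>
      mxtens.tensmx (e ord0) (tensor_ket_rec (fun k => e (lift ord0 k)))
  end.

(* The empty tensor product is the scalar 1. *)
Definition tensor_ket (C : numClosedFieldType) (d n : nat) :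
    ('I_n -> 'cV[C]_d) -> 'cV[C]_(d ^ n) :=
  match n with
  | 0 => fun=> 1
  | n'.+1 => @tensor_ket_rec C d n'
  end.

(* Multi-indices i^n in [d]^n are functions {ffun 'I_n -> 'I_d}. *)
Definition prod_eigenvalue (C : numClosedFieldType) (d n : nat)
    (lambda : 'I_d -> C) (i : {ffun 'I_n -> 'I_d}) : C :=
  \prod_(k < n) lambda (i k).

(* The vector |i^n; g>. *)
Definition orbit_ket (C : numClosedFieldType) (G : finGroupType) (d n : nat)
    (U : G -> 'M[C]_d) (e : 'I_d -> 'cV[C]_d)
    (i : {ffun 'I_n -> 'I_d}) (g : G) : 'cV[C]_(d ^ n) :=
  tensor_power (U g) n *m tensor_ket (fun k => e (i k)).

(* Main.v *)
Require Import Defs.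
From HB Require Import structures.
From mathcomp Require Import all_boot all_order all_fingroup all_algebra.
From mathcomp Require Import spectral sesquilinear complex reals.
From mathcomp Require Import ring.

Set Implicit Arguments.
Unset Strict Implicit.
Unset Printing Implicit Defensive.

Import Order.TTheory GRing.Theory Num.Theory.

Local Open Scope ring_scope.
Local Open Scope sesquilinear_scope.

(** Since sigma_g^(⊗n) = \sum_i lambda_i |i;g><i;g|, both ensembles have the same
    average state S, so both pretty good measurements are built from the same
    W = S^(-1/2). Then p_PGM(E) is the sum over g, i, j of
    lambda_i lambda_j |<i;g|W|j;g>|^2 / |G|^2, and p_PGM(F) is the part i = j of
    this sum. For the second bound, a unit vector v in the support of S satisfies
    <v|S^(-1/2)|v>^2 <v|S|v> >= 1, by Hölder's inequality for the distribution of
    the eigenvalues of S in the state v; and <i;g|S|i;g> does not depend on g,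
    because S is invariant under the conjugation by U_g^(⊗n). *)

(** * Adjoints, brakets and rank-one operators *)

Lemma adjmx_mul (C : numClosedFieldType) (m n p : nat) (A : 'M[C]_(m, n))
  (B : 'M[C]_(n, p)) : (A *m B)^t* = B^t* *m A^t*.
Proof. by rewrite trmx_mul map_mxM. Qed.

Lemma hermsymmxP (C : numClosedFieldType) (d : nat) (A : 'M[C]_d) :
  reflect (A^t* = A) (A \is hermsymmx).
Proof.
by apply: (iffP (is_hermitianmxP _ _ _)); rewrite expr0 scale1r => /esym.
Qed.

Lemma braket_conj (C : numClosedFieldType) (d : nat) (u v : 'cV[C]_d) :
  (braket u v)^* = braket v u.
Proof.
rewrite /braket !mxE rmorph_sum; apply: eq_bigr => k _.
by rewrite !mxE rmorphM /= conjCK mulrC.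
Qed.

Lemma braket_self (C : numClosedFieldType) (d : nat) (v : 'cV[C]_d) :
  braket v v = \sum_k `|v k 0| ^+ 2.
Proof.
by rewrite /braket mxE; apply: eq_bigr => k _; rewrite !mxE mulrC normCK.
Qed.

Lemma braket_delta (C : numClosedFieldType) (d : nat) (v : 'cV[C]_d)
  (k : 'I_d) : braket (delta_mx k 0) v = v k 0.
Proof.
rewrite /braket mxE (bigD1 k) //= big1 => [|j njk]; rewrite !mxE ?eqxx.
  by rewrite rmorph1 mul1r addr0.
by rewrite (negPf njk) rmorph0 mul0r.
Qed.

Lemma braket_adj (C : numClosedFieldType) (d : nat) (A : 'M[C]_d)
  (u v : 'cV[C]_d) : braket u (A *m v) = braket (A^t* *m u) v.
Proof. by rewrite /braket adjmx_mul trmxCK mulmxA. Qed.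

Lemma ketbra_mul (C : numClosedFieldType) (d : nat) (v w : 'cV[C]_d) :
  ketbra v *m w = braket v w *: v.
Proof.
rewrite /ketbra -mulmxA; apply/matrixP => a b.
by rewrite !mxE big_ord1 (ord1 b) mulrC.
Qed.

Lemma braketZr (C : numClosedFieldType) (d : nat) (a : C) (u v : 'cV[C]_d) :
  braket u (a *: v) = a * braket u v.
Proof. by rewrite /braket -scalemxAr mxE. Qed.

Lemma braket_ketbra (C : numClosedFieldType) (d : nat) (u v w : 'cV[C]_d) :
  braket u (ketbra v *m w) = braket v w * braket u v.
Proof. by rewrite ketbra_mul braketZr. Qed.

Lemma mxtrace_mul_ketbra (C : numClosedFieldType) (d : nat) (A : 'M[C]_d)
  (v : 'cV[C]_d) : \tr (A *m ketbra v) = braket v (A *m v).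
Proof. by rewrite /ketbra mulmxA mxtrace_mulC /braket trace_mx11. Qed.

Lemma braket_sum (C : numClosedFieldType) (I : finType) (d : nat) (p : I -> C)
  (A : I -> 'M[C]_d) (u v : 'cV[C]_d) :
  braket u ((\sum_i p i *: A i) *m v) = \sum_i p i * braket u (A i *m v).
Proof.
rewrite /braket mulmx_suml mulmx_sumr summxE; apply: eq_bigr => i _.
by rewrite -scalemxAl -scalemxAr mxE.
Qed.

Lemma mul_conj_braket_ge0 (C : numClosedFieldType) (d : nat) (u v : 'cV[C]_d) :
  0 <= braket u v * braket v u.
Proof. by rewrite -(braket_conj u v) mul_conjC_ge0. Qed.

(** * Positive semidefinite operators and the inverse square root *)

Lemma psdmx_sum_ketbra (C : numClosedFieldType) (I : finType) (d : nat)
  (p : I -> C) (v : I -> 'cV[C]_d) :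
  (forall i, 0 <= p i) -> psdmx (\sum_i p i *: ketbra (v i)).
Proof.
move=> p0; split=> [|u]; last first.
  rewrite braket_sum sumr_ge0 // => i _.
  by rewrite braket_ketbra mulr_ge0 ?mul_conj_braket_ge0.
apply/hermsymmxP; rewrite linear_sum /= rmorph_sum /=; apply: eq_bigr => i _.
rewrite linearZ /= map_mxZ /ketbra adjmx_mul trmxCK.
by congr (_ *: _); apply: geC0_conj.
Qed.

Lemma braket_diag (C : numClosedFieldType) (d : nat) (P : 'M[C]_d)
  (D : 'rV[C]_d) (v : 'cV[C]_d) :
  braket v (P^t* *m diag_mx D *m P *m v) =
  \sum_k D 0 k * `|(P *m v) k 0| ^+ 2.
Proof.
rewrite -!mulmxA braket_adj trmxCK /braket mxE; apply: eq_bigr => k _.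
by rewrite !mul_diag_mx !mxE normCK mulrCA [_^* * _]mulrC.
Qed.

Lemma psdmx_spectral (C : numClosedFieldType) (d : nat) (A : 'M[C]_d) :
  psdmx A ->
  A = (spectralmx A)^t* *m diag_mx (spectral_diag A) *m spectralmx A.
Proof.
case=> /hermitian_normalmx/orthomx_spectralP eqA _.
by rewrite -invmx_unitary ?spectral_unitarymx.
Qed.

(** Here [u] is the [k]-th unit eigenvector of [A]. Writing an eigenvalue as an expectation value
    lets bounds on quadratic forms be read as bounds on the spectrum. *)
Lemma spectral_diag_braket (C : numClosedFieldType) (d : nat) (A : 'M[C]_d)
  (k : 'I_d) : psdmx A ->
  let u := (spectralmx A)^t* *m delta_mx k 0 in
  spectral_diag A 0 k = braket u (A *m u).
Proof.
move=> psdA u; rewrite {2}(psdmx_spectral psdA) braket_diag.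
rewrite /u mulmxA (unitarymxP (spectral_unitarymx A)) mul1mx.
rewrite (bigD1 k) //= big1 => [|j njk]; rewrite !mxE ?eqxx.
  by rewrite normr1 expr1n mulr1 addr0.
by rewrite (negPf njk) normr0 expr0n mulr0.
Qed.

Lemma spectral_diag_ge0 (C : numClosedFieldType) (d : nat) (A : 'M[C]_d)
  (k : 'I_d) : psdmx A -> 0 <= spectral_diag A 0 k.
Proof.
by move=> psdA; rewrite spectral_diag_braket //; case: psdA => _; apply.
Qed.

Lemma invsqrtmx_herm (C : numClosedFieldType) (d : nat) (A : 'M[C]_d) :
  psdmx A -> (invsqrtmx A)^t* = invsqrtmx A.
Proof.
move=> psdA; rewrite /invsqrtmx !adjmx_mul trmxCK mulmxA; congr (_ *m _ *m _).
rewrite tr_diag_mx map_diag_mx; congr diag_mx; apply/rowP => k.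
by rewrite !mxE; apply: geC0_conj; rewrite invr_ge0 sqrtC_ge0 spectral_diag_ge0.
Qed.

(** Averaging over [p] the AM-GM inequality for A^2 s and two copies of 1/(A sqrt s), whose product
    is 1, gives 3 <= A^2 E[s] + 2. Since the inverse of 0 is 0, mass of [p] at zeros of [s] would be
    lost from A; the third hypothesis excludes it. *)
Lemma ler1_sqr_mean_invsqrtC_mul_mean (C : numClosedFieldType) (I : finType)
  (s p : I -> C) : (forall k, 0 <= s k) -> (forall k, 0 <= p k) ->
  (forall k, s k = 0 -> p k = 0) -> \sum_k p k = 1 ->
  1 <= (\sum_k (sqrtC (s k))^-1 * p k) ^+ 2 * \sum_k s k * p k.
Proof.
move=> s0 p0 sp p1; set A := \sum_k (sqrtC (s k))^-1 * p k.
have term0 k : 0 <= (sqrtC (s k))^-1 * p k.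
  by rewrite mulr_ge0 // invr_ge0 sqrtC_ge0.
have A_ge0 : 0 <= A by apply: sumr_ge0.
have A_gt0 : 0 < A.
  (* If A were 0, every term would vanish; each then forces [p k = 0], directly or through
     [s k = 0], against total mass 1. *)
  rewrite lt_def A_ge0 andbT; apply/eqP => A0.
  have /psumr_eq0P H : forall k, true -> 0 <= (sqrtC (s k))^-1 * p k by [].
  suff : \sum_k p k = 0 by rewrite p1; apply/eqP; rewrite oner_eq0.
  apply: big1 => k _; have /eqP := H A0 k isT.
  by rewrite mulf_eq0 invr_eq0 sqrtC_eq0 => /orP[/eqP/sp|/eqP].
have key k : 3 * p k <= A ^+ 2 * (s k * p k)
                        + 2 / A * ((sqrtC (s k))^-1 * p k).
  have [sk0|sk0] := eqVneq (s k) 0.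
    by rewrite sp // !mulr0 addr0.
  rewrite [s k * _]mulrC [_^-1 * _]mulrC.
  rewrite -[in A ^+ 2 * _](sqrtCK (s k)).
  have x0 : 0 < sqrtC (s k) by rewrite sqrtC_gt0 lt_neqAle eq_sym sk0 s0.
  move: (sqrtC _) x0 => x x0; pose y := A * x.
  have y0 : 0 < y by rewrite mulr_gt0.
  (* AM-GM for y ^ 2, 1 / y, 1 / y: the gap times y is (y - 1)^2 (y + 2). *)
  rewrite -subr_ge0.
  have -> : A ^+ 2 * (p k * x ^+ 2) + 2 / A * (p k / x) - 3 * p k =
     p k * (y - 1) ^+ 2 * (y + 2) / y.
    by rewrite /y; field; rewrite ?gt_eqF.
  have sq_ge0 : 0 <= (y - 1) ^+ 2.
    by rewrite real_exprn_even_ge0 // realB ?ger0_real ?ler01 ?ltW.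
  rewrite divr_ge0 ?(ltW y0) // mulr_ge0 //; first exact: mulr_ge0.
  by rewrite addr_ge0 ?ler0n // ltW.
have : 3 <= A ^+ 2 * (\sum_k s k * p k) + 2 / A * A.
  have -> : 3 = \sum_k 3 * p k by rewrite -mulr_sumr p1 mulr1.
  rewrite {3}/A !mulr_sumr -big_split /=.
  exact: ler_sum.
by rewrite divfK ?gt_eqF // -lerBlDr -natrB.
Qed.

(** The last hypothesis, c |v><v| <= A as quadratic forms, places [v] in the support of [A]. The
    previous inequality is then applied to the squared moduli of the coordinates of [v] in the
    eigenbasis. *)
Lemma invsqrtmx_braket_ge (C : numClosedFieldType) (d : nat) (A : 'M[C]_d)
  (c : C) (v : 'cV[C]_d) : psdmx A -> 0 < c -> braket v v = 1 ->
  (forall u, c * (braket u v * braket v u) <= braket u (A *m u)) ->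
  (braket v (A *m v))^-1 <= braket v (invsqrtmx A *m v) ^+ 2.
Proof.
move=> psdA c0 v1 cA.
have vAv : 0 < braket v (A *m v).
  by apply: lt_le_trans (cA v); rewrite v1 !mulr1.
rewrite -[leLHS]mul1r ler_pdivrMr //.
rewrite {2}(psdmx_spectral psdA) /invsqrtmx !braket_diag.
under eq_bigr do rewrite mxE.
apply: ler1_sqr_mean_invsqrtC_mul_mean => [k|k|k Dk|].
- exact: spectral_diag_ge0.
- by rewrite exprn_ge0.
(* Testing the hypothesis on an eigenvector u of eigenvalue 0 gives c |<u|v>|^2 <= 0. *)
- have := cA ((spectralmx A)^t* *m delta_mx k 0).
  rewrite -spectral_diag_braket // Dk pmulr_rle0 //.
  rewrite -(braket_conj _ v) -normCK -braket_adj braket_delta => H.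
  by apply/eqP; rewrite eq_le H exprn_ge0.
- rewrite -braket_self braket_adj mulmxA.
  by rewrite (mulmx1C (unitarymxP (spectral_unitarymx A))) mul1mx.
Qed.

(** * Success probabilities of pretty good measurements *)

Lemma eq_p_pgm (C : numClosedFieldType) (X : finType) (d : nat) (p q : X -> C)
  (rho tau : X -> 'M[C]_d) : p =1 q -> rho =1 tau ->
  p_pgm p rho = p_pgm q tau.
Proof.
move=> pq rt; have avE : average_state p rho = average_state q tau.
  by apply: eq_bigr => x _; rewrite pq rt.
by apply: eq_bigr => x _; rewrite /pgm avE pq rt.
Qed.

Lemma p_pgm_pure (C : numClosedFieldType) (X : finType) (d : nat) (p : X -> C)
  (v : X -> 'cV[C]_d) :
  let W := invsqrtmx (average_state p (fun x => ketbra (v x))) in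
  p_pgm p (fun x => ketbra (v x)) =
  \sum_x p x ^+ 2 * braket (v x) (W *m v x) ^+ 2.
Proof.
move=> W; apply: eq_bigr => x _; rewrite /pgm -/W /=.
rewrite -scalemxAl mxtraceZ mxtrace_mul_ketbra mulrA -expr2; congr (_ * _).
by rewrite -2!mulmxA ketbra_mul -scalemxAr braketZr expr2.
Qed.

Lemma p_pgm_pure_ge (C : numClosedFieldType) (X : finType) (d : nat)
  (p : X -> C) (v : X -> 'cV[C]_d) :
  (forall x, 0 <= p x) -> (forall x, braket (v x) (v x) = 1) ->
  \sum_x p x ^+ 2 /
    braket (v x) (average_state p (fun x => ketbra (v x)) *m v x) <=
  p_pgm p (fun x => ketbra (v x)).
Proof.
move=> p0 v1; rewrite p_pgm_pure; apply: ler_sum => x _.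
(* A state of weight 0 may lie outside the support of the average, but contributes 0 to both
   sides. *)
have [->|px0] := eqVneq (p x) 0; first by rewrite expr0n !mul0r.
apply: ler_wpM2l; first by rewrite exprn_ge0.
apply: (@invsqrtmx_braket_ge _ _ _ (p x)) => //.
- exact: psdmx_sum_ketbra.
- by rewrite lt_def px0 p0.
(* The average state dominates its own [x] term, the other terms being positive semidefinite. *)
move=> u; rewrite braket_sum (bigD1 x) //= braket_ketbra [braket u _ * _]mulrC.
rewrite lerDl sumr_ge0 // => y _.
by rewrite braket_ketbra mulr_ge0 ?mul_conj_braket_ge0.
Qed.

(* Both ensembles have the same average state, and the left side collects the
   diagonal terms of the nonnegative double sum given by the right side. *)
Lemma p_pgm_refine_le (C : numClosedFieldType) (I X : finType) (d : nat)
  (l : I -> C) (p : X -> C) (v : I -> X -> 'cV[C]_d) :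
  (forall i, 0 <= l i) -> (forall x, 0 <= p x) ->
  p_pgm (fun y : I * X => l y.1 * p y.2) (fun y => ketbra (v y.1 y.2)) <=
  p_pgm p (fun x => \sum_i l i *: ketbra (v i x)).
Proof.
move=> l0 p0; pose S := average_state (fun y : I * X => l y.1 * p y.2)
  (fun y => ketbra (v y.1 y.2)).
have psdS : psdmx S.
  by apply: psdmx_sum_ketbra => y; rewrite mulr_ge0.
have SE : average_state p (fun x => \sum_i l i *: ketbra (v i x)) = S.
  rewrite /S /average_state -(pair_bigA _ (fun i x =>
    (l i * p x) *: ketbra (v i x))) /= exchange_big; apply: eq_bigr => x _ /=.
  by rewrite scaler_sumr; apply: eq_bigr => i _; rewrite scalerA mulrC.
pose W := invsqrtmx S; have Wherm : W^t* = W by apply: invsqrtmx_herm.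
have WW u w : braket u (W *m w) * braket w (W *m u) = `|braket u (W *m w)| ^+ 2.
  by rewrite normCK braket_conj [braket w _]braket_adj Wherm.
rewrite (p_pgm_pure _ (fun y : I * X => v y.1 y.2)) -/S -/W.
rewrite -(pair_bigA _ (fun i x =>
  (l i * p x) ^+ 2 * braket (v i x) (W *m v i x) ^+ 2)) /= exchange_big.
apply: ler_sum => x _; rewrite /pgm SE -/W -scalemxAl mxtraceZ mulrA -expr2.
set r := \sum_i l i *: _.
(* Both copies of [r] are expanded; as [W] is Hermitian, the two resulting brakets are conjugate to
   each other. *)
have -> : \tr (W *m r *m W *m r) =
    \sum_i \sum_j l i * l j * `|braket (v i x) (W *m v j x)| ^+ 2.
  rewrite {2}/r mulmx_sumr raddf_sum; apply: eq_bigr => i _ /=.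
  rewrite -scalemxAr mxtraceZ mxtrace_mul_ketbra -2!mulmxA braket_adj.
  rewrite Wherm braket_sum mulr_sumr; apply: eq_bigr => j _.
  rewrite braket_ketbra -WW [braket (v i x) _]braket_adj Wherm.
  by rewrite -mulrA [braket (v j x) _ * _]mulrC.
rewrite mulr_sumr; apply: ler_sum => i _.
rewrite (bigD1 i) //= mulrDr -WW.
rewrite [leLHS](_ : _ = p x ^+ 2 * (l i * l i * (braket (v i x) (W *m v i x)
  * braket (v i x) (W *m v i x)))); last by ring.
rewrite lerDl mulr_ge0 ?exprn_ge0 //.
by apply: sumr_ge0 => j _; rewrite !mulr_ge0 ?exprn_ge0.
Qed.

(** * Tensor powers *)

Lemma tensor_power_ket (C : numClosedFieldType) (d n : nat) (A : 'M[C]_d)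
  (u : 'I_n -> 'cV[C]_d) :
  tensor_power A n *m tensor_ket u = tensor_ket (fun k => A *m u k).
Proof.
case: n u => [|n] u; first exact: mul1mx.
rewrite /tensor_power /mxtens.ntensmx /=.
elim: n u => [//|n IHn] u /=.
(* The dimensions in the mixed-product rule match those of the goal only up to conversion. *)
have := mxtens.tensmx_mul A (mxtens.ntensmx_rec A n) (u ord0)
  (tensor_ket_rec (fun k => u (lift ord0 k))).
by rewrite IHn.
Qed.

Lemma adj_tensmx (C : numClosedFieldType) (m n p q : nat) (A : 'M[C]_(m, n))
  (B : 'M[C]_(p, q)) :
  (mxtens.tensmx A B)^t* = mxtens.tensmx (A^t*) (B^t*).
Proof. by rewrite mxtens.trmx_tens mxtens.map_mxT. Qed.

Lemma braket_tensor_ket (C : numClosedFieldType) (d n : nat)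
  (u v : 'I_n -> 'cV[C]_d) :
  braket (tensor_ket u) (tensor_ket v) = \prod_k braket (u k) (v k).
Proof.
case: n u v => [|n] u v.
  by rewrite big_ord0 /braket trmx1 map_mx1 mulmx1 mxE eqxx.
rewrite /braket /=; elim: n u v => [|n IHn] u v /=; first by rewrite big_ord1.
rewrite big_ord_recl -IHn.
have := mxtens.tensmx_mul ((u ord0)^t*)
  ((tensor_ket_rec (fun k => u (lift ord0 k)))^t*) (v ord0)
  (tensor_ket_rec (fun k => v (lift ord0 k))).
rewrite -adj_tensmx => /matrixP/(_ (0 : 'I_1) (0 : 'I_1)) ->.
by rewrite mxE [(mxtens.mxtens_unindex _).1]ord1 [(mxtens.mxtens_unindex _).2]ord1.
Qed.

(** Base-[d] digits of an index, following the recursion of [mxtens.ntensmx_rec]. With them, entries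
    of tensor powers become plain products over the factors. *)
Fixpoint tensor_digit (d n : nat) : 'I_(d ^ n.+1) -> 'I_n.+1 -> 'I_d :=
  match n with
  | 0 => fun a _ => a
  | n'.+1 => fun a k =>
      if unlift ord0 k is Some k'
      then tensor_digit (@mxtens.mxtens_unindex d (d ^ n'.+1) a).2 k'
      else (@mxtens.mxtens_unindex d (d ^ n'.+1) a).1
  end.

Lemma ntensmx_rec_digit (C : numClosedFieldType) (d n : nat) (A : 'M[C]_d) a b :
  mxtens.ntensmx_rec A n a b =
  \prod_k A (tensor_digit a k) (tensor_digit b k).
Proof.
elim: n a b => [|n IHn] a b /=; first by rewrite big_ord1.
rewrite big_ord_recl unlift_none mxE IHn; congr (_ * _).
by apply: eq_bigr => k _; rewrite liftK.
Qed.

Lemma tensor_ket_rec_digit (C : numClosedFieldType) (d n : nat)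
  (u : 'I_n.+1 -> 'cV[C]_d) a :
  tensor_ket_rec u a 0 = \prod_k u k (tensor_digit a k) 0.
Proof.
elim: n u a => [|n IHn] u a /=; first by rewrite big_ord1.
rewrite big_ord_recl unlift_none mxE !ord1 IHn; congr (_ * _).
by apply: eq_bigr => k _; rewrite liftK.
Qed.

(** Each entry of the left side is a product over [k] of sums over [j]; distributing it yields a sum
    over all multi-indices. *)
Lemma tensor_power_sum_ketbra (C : numClosedFieldType) (d m n : nat)
  (l : 'I_m -> C) (u : 'I_m -> 'cV[C]_d) :
  tensor_power (\sum_j l j *: ketbra (u j)) n =
  \sum_(i : {ffun 'I_n -> 'I_m})
    (\prod_k l (i k)) *: ketbra (tensor_ket (fun k => u (i k))).
Proof.
case: n => [|n].
  rewrite [RHS](eq_bigr (fun=> 1)) => [|i _].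
    (* For n = 0 there is exactly one multi-index, even when m = 0. *)
    have card1 : #|{: {ffun 'I_0 -> 'I_m}}| = 1%N by rewrite card_ffun !card_ord.
    by rewrite sumr_const (_ : #|_| = 1%N) ?mulr1n //.
  by rewrite big_ord0 scale1r /ketbra trmx1 map_mx1 mulmx1.
apply/matrixP => a b; rewrite ntensmx_rec_digit summxE.
under eq_bigr => k _ do rewrite summxE.
rewrite bigA_distr_bigA; apply: eq_bigr => i _ /=.
rewrite !mxE big_ord1 !mxE !tensor_ket_rec_digit rmorph_prod -!big_split /=.
by apply: eq_bigr => k _; rewrite !mxE big_ord1 !mxE.
Qed.

(** * Orbits under the projective representation *)

Lemma orbit_state_sum (C : numClosedFieldType) (G : finGroupType) (d m : nat)
  (U : G -> 'M[C]_d) (l : 'I_m -> C) (u : 'I_m -> 'cV[C]_d) (g : G) :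
  orbit_state U (\sum_j l j *: ketbra (u j)) g =
  \sum_j l j *: ketbra (U g *m u j).
Proof.
rewrite /orbit_state mulmx_sumr mulmx_suml; apply: eq_bigr => j _.
by rewrite -scalemxAr -scalemxAl /ketbra adjmx_mul !mulmxA.
Qed.

(** The phase c(g,h) meets its conjugate under conjugation, so the projective action is a genuine
    action on operators. *)
Lemma orbit_state_mul (C : numClosedFieldType) (G : finGroupType) (d : nat)
  (U : G -> 'M[C]_d) (A : 'M[C]_d) (g h : G) : projective_unitary_rep U ->
  orbit_state U A (g * h)%g = U g *m orbit_state U A h *m (U g)^t*.
Proof.
case=> _ [c cP]; have [c1 UU] := cP g h.
have c0 : c g h != 0 by rewrite -normr_eq0 c1 oner_eq0.
have -> : U g *m orbit_state U A h *m (U g)^t* =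
    (U g *m U h) *m A *m (U g *m U h)^t*.
  by rewrite adjmx_mul /orbit_state !mulmxA.
rewrite UU linearZ /= map_mxZ -!scalemxAl -scalemxAr scalerA.
by rewrite -normCK c1 expr1n scale1r.
Qed.

Lemma braket_unitary (C : numClosedFieldType) (d : nat) (V A : 'M[C]_d)
  (u v : 'cV[C]_d) : V \is unitarymx ->
  braket (V *m u) ((V *m A *m V^t*) *m (V *m v)) = braket u (A *m v).
Proof.
move=> /unitarymxP/mulmx1C VV; rewrite -!mulmxA [V^t* *m _]mulmxA VV mul1mx.
by rewrite braket_adj mulmxA VV mul1mx.
Qed.

(* In the last sum, terms with [prod_eigenvalue lambda i = 0] are 0, as division
   is total. *)
Theorem mainTheorem11 (R : realType) (G : finGroupType) (d : nat)
    (U : G -> 'M[R[i]]_d) (hU : projective_unitary_rep U)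
    (sigma : 'M[R[i]]_d) (hsigma : quantum_state sigma)
    (lambda : 'I_d -> R[i]) (e : 'I_d -> 'cV[R[i]]_d)
    (he : orthonormal_kets e)
    (hspec : sigma = \sum_(i < d) lambda i *: ketbra (e i))
    (n : nat) :
  let p_E : R[i] :=
    p_pgm (fun _ : G => #|G|%:R^-1)
          (fun g : G => tensor_power (orbit_state U sigma g) n) in
  let p_F : R[i] :=
    p_pgm (fun x : {ffun 'I_n -> 'I_d} * G =>
             prod_eigenvalue lambda x.1 / #|G|%:R)
          (fun x : {ffun 'I_n -> 'I_d} * G =>
             ketbra (orbit_ket U e x.1 x.2)) in
  p_E >= p_F /\
  p_F >= \sum_(i : {ffun 'I_n -> 'I_d})
           (prod_eigenvalue lambda i) ^+ 2 /
           (\sum_(h : G) \prod_(k < n)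
              braket (e (i k)) (orbit_state U sigma h *m e (i k))).
Proof.
(* Orthonormality gives lambda_j = <e_j|sigma|e_j>. *)
have lam0 j : 0 <= lambda j.
  have [[_ psd] _] := hsigma; move: (psd (e j)).
  rewrite hspec braket_sum (bigD1 j) //= big1 => [|k nkj].
    by rewrite braket_ketbra he eqxx !mulr1 addr0.
  by rewrite braket_ketbra [braket (e j) _]he eq_sym (negPf nkj) !mulr0.
have prod0 (i : {ffun 'I_n -> 'I_d}) : 0 <= prod_eigenvalue lambda i.
  by apply: prodr_ge0 => k _.
have G0 : #|G|%:R != 0 :> R[i].
  by rewrite pnatr_eq0 -lt0n; apply/card_gt0P; exists 1%g.
have Ginv0 : 0 <= #|G|%:R^-1 :> R[i] by rewrite invr_ge0 ler0n.
have rhoE g : tensor_power (orbit_state U sigma g) n =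
    \sum_(i : {ffun 'I_n -> 'I_d})
      prod_eigenvalue lambda i *: ketbra (orbit_ket U e i g).
  rewrite hspec orbit_state_sum tensor_power_sum_ketbra.
  by apply: eq_bigr => i _; rewrite /orbit_ket tensor_power_ket.
move=> p_E p_F; split.
  rewrite [leRHS](eq_p_pgm (frefl _) rhoE).
  exact: (p_pgm_refine_le (orbit_ket U e) prod0 (fun=> Ginv0)).
have v1 (x : {ffun 'I_n -> 'I_d} * G) :
    braket (orbit_ket U e x.1 x.2) (orbit_ket U e x.1 x.2) = 1.
  rewrite /orbit_ket tensor_power_ket braket_tensor_ket big1 // => k _.
  rewrite braket_adj mulmxA (mulmx1C (unitarymxP (proj1 hU x.2))) mul1mx.
  by rewrite he eqxx.
(* The general bound for pure states will turn out to equal the claimed sum, term by term in [i]. *)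
apply: le_trans (p_pgm_pure_ge _ v1); last first.
  by move=> x; rewrite mulr_ge0.
set S := average_state _ _.
have SE : S = \sum_g #|G|%:R^-1 *: tensor_power (orbit_state U sigma g) n.
  rewrite /S /average_state -(pair_bigA _ (fun i g =>
    (prod_eigenvalue lambda i / #|G|%:R) *: ketbra (orbit_ket U e i g))) /=.
  rewrite exchange_big; apply: eq_bigr => g _ /=.
  by rewrite rhoE scaler_sumr; apply: eq_bigr => i _; rewrite scalerA mulrC.
rewrite -(pair_bigA _ (fun i g =>
  (prod_eigenvalue lambda i / #|G|%:R) ^+ 2 /
  braket (orbit_ket U e i g) (S *m orbit_ket U e i g))) /=.
apply: ler_sum => i _; set N := \sum_h _.
have SN g : braket (orbit_ket U e i g) (S *m orbit_ket U e i g) = N / #|G|%:R.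
  rewrite SE braket_sum -mulr_sumr mulrC; congr (_ * _).
  (* Substituting g h for h makes U_g act on both the state and the kets, where it cancels by
     unitarity. *)
  rewrite (reindex_inj (mulgI g)); apply: eq_bigr => h _ /=.
  rewrite /orbit_ket !tensor_power_ket braket_tensor_ket.
  by apply: eq_bigr => k _; rewrite orbit_state_mul // braket_unitary ?(proj1 hU).
under eq_bigr do rewrite SN.
(* The sum over G has |G| equal terms (lambda_i / |G|)^2 / (N / |G|). *)
rewrite sumr_const (_ : #|_| = #|G|) // -[leRHS]mulr_natr.
rewrite [leRHS](_ : _ = prod_eigenvalue lambda i ^+ 2 / N) //.
(* When N = 0, both sides are 0 by the convention for division by 0. *)
have [->|N0] := eqVneq N 0; first by rewrite !(mul0r, invr0, mulr0).
by field; rewrite G0 N0.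
Qed.
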